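(* Let $\mathcal K$ be a quantum channel on $n\times n$ density matrices with Kraus operators $K_1,\dots,K_d\in\mathbb C^{n\times n}$, i.e. $\mathcal K(\rho)=\sum_{j=1}^d K_j\rho K_j^\dagger$ with $\sum_{j=1}^d K_j^\dagger K_j=I_n$. Then $$\lVert\mathcal K\rVert=\cos^{-1}\left[\max_{\mathbf v\in\mathbb C^d,\ \lVert\mathbf v\rVert\le 1}\ \tfrac12\,\lambda_{\min}\!\left(K_{\mathbf v}+K_{\mathbf v}^\dagger\right)\right],$$ where $\lVert\mathbf v\rVert$ is the Euclidean ($\ell_2$) norm, $K_{\mathbf v}=\sum_{j=1}^d v_jK_j$, $\lambda_{\min}$ denotes the smallest eigenvalue, and $\cos^{-1}$ takes values in $[0,\pi]$.
   Context: For a unitary matrix $U$ of size $r$ with eigenvalues $e^{i\theta_j}$, $\theta_j\in(-\pi,\pi]$, its time-energy cost is $\lVert U\rVert=\max_{1\le j\le r}|\theta_j|$. For a quantum channel $\mathcal K$ acting on an $n$-dimensional system $A$, its time-energy cost is $\lVert\mathcal K\rVert=\inf_U\lVert U\rVert$, where the infimum is over all finite-dimensional ancilla systems $B$ with a fixed standard state $|0\rangle_B$ and all unitaries $U_{BA}$ on $B\otimes A$ such that $\mathcal K(\rho)=\mathrm{Tr}_B[U_{BA}(|0\rangle_B\langle 0|\otimes\rho_A)U_{BA}^\dagger]$ for all density matrices $\rho$ on $A$. *)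

(* Defs.v *)
From HB Require Import structures.
From mathcomp Require Import all_boot all_order all_algebra.
From mathcomp Require Import all_classical all_reals all_analysis.
From mathcomp Require Import complex mxtens.
Set Implicit Arguments. Unset Strict Implicit. Unset Printing Implicit Defensive.
Import Order.TTheory GRing.Theory Num.Theory.
Local Open Scope ring_scope.
Local Open Scope classical_set_scope.

Section Defs.
Variable R : realType.
Local Notation C := R[i].

Definition adjmx {m n} (A : 'M[C]_(m, n)) : 'M[C]_(n, m) := (map_mx (@conjc R) A)^T.

Definition unitarymx {m} (U : 'M[C]_m) : Prop := U *m adjmx U = 1%:M.

Definition hermitian {m} (A : 'M[C]_m) : Prop := adjmx A = A.

Definition psd {m} (A : 'M[C]_m) : Prop :=
  forall x : 'cV[C]_m, 0 <= (adjmx x *m A *m x) 0 0.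

Definition density {m} (rho : 'M[C]_m) : Prop :=
  hermitian rho /\ psd rho /\ \tr rho = 1.

Definition spectrum {m} (A : 'M[C]_m) : set C := [set a | eigenvalue A a].

Definition unitary_cost {m} (U : 'M[C]_m) : R :=
  sup [set `|t| | t in [set t : R | - pi < t <= pi /\
                         spectrum U ((cos t) +i* (sin t))%C]].

Definition ptraceB {mB n} (X : 'M[C]_(mB * n)) : 'M[C]_n :=
  \matrix_(a, a') \sum_(b < mB) X (mxtens_index (b, a)) (mxtens_index (b, a')).

Definition ket0bra0 (m : nat) : 'M[C]_(m.+1) := delta_mx ord0 ord0.

Definition dilates {n} (Kc : 'M[C]_n -> 'M[C]_n) (m : nat) (U : 'M[C]_(m.+1 * n)) : Prop :=
  unitarymx U /\
  forall rho : 'M[C]_n, density rho ->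
    Kc rho = ptraceB (U *m (ket0bra0 m *t rho) *m adjmx U).

Definition channel_cost {n} (Kc : 'M[C]_n -> 'M[C]_n) : R :=
  inf [set c : R | exists (m : nat) (U : 'M[C]_(m.+1 * n)),
                     dilates Kc U /\ c = unitary_cost U].

Definition kraus_channel {n d} (K : 'I_d -> 'M[C]_n) (rho : 'M[C]_n) : 'M[C]_n :=
  \sum_(j < d) K j *m rho *m adjmx (K j).

Definition vnorm {d} (v : 'I_d -> C) : R :=
  Num.sqrt (\sum_(j < d) (complex.Re (v j) ^+ 2 + complex.Im (v j) ^+ 2)).

Definition Kv {n d} (K : 'I_d -> 'M[C]_n) (v : 'I_d -> C) : 'M[C]_n :=
  \sum_(j < d) v j *: K j.

(* smallest eigenvalue of a Hermitian matrix (its eigenvalues are real) *)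
Definition lambda_min {n} (H : 'M[C]_n) : R :=
  inf [set complex.Re a | a in spectrum H].

End Defs.

(* Main.v *)
(** Let [f v] be half the smallest eigenvalue of [K_v + K_v^*]; it is also the largest [s] with
    [K_v + K_v^* >= 2 s], which makes it Lipschitz in [v], so a maximiser exists.

    Lower bound: if [U] dilates the channel, the blocks of its first block column are Kraus
    operators of the channel, so the (0,0) block is [K_v] for some [v] in the unit ball (the
    minimal-norm solution for Choi vectors).  If the eigenvalues of [U] have angles at most [c],
    then [U + U^* >= 2 cos c], and compressing to [|0>] gives [f v >= cos c].

    Upper bound: for [v] in the unit ball there are [d + 1] Kraus operators starting with [K_v];
    stack them into an isometry [V] and let [E] be the embedding onto [|0>].  A unitary [U] with
    [U E = V] and angles at most [c] is the Cayley transform [(1 - iM)^-1 (1 + iM)] of a Hermitian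
    [M] with [M (V + E) = - i (V - E)] and [M^2 <= tan^2 (c / 2)].  On the range of [V + E] this
    prescribes a symmetric operator of norm less than [tan (c / 2)] whenever [cos c < f v], so [M]
    exists by Krein's norm-preserving extension of symmetric contractions.  The infimum only needs
    the strict inequality, which avoids square roots and singular cases in Krein's formula. *)
Require Import Defs.
From HB Require Import structures.
From mathcomp Require Import all_boot all_order all_algebra.
From mathcomp Require Import all_classical all_reals all_analysis.
From mathcomp Require Import complex mxtens ring lra.
Set Implicit Arguments. Unset Strict Implicit. Unset Printing Implicit Defensive.
Import Order.TTheory GRing.Theory Num.Theory.
Local Open Scope ring_scope.

Local Notation "A ^h" := (adjmx A) (at level 2, format "A ^h").

(** * Adjoints and positive semidefinite matrices *)

Lemma adjmxE (R : realType) m n (A : 'M[R[i]]_(m, n)) i j :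
  A^h i j = conjc (A j i).
Proof. by rewrite !mxE. Qed.

Lemma adjmxK (R : realType) m n (A : 'M[R[i]]_(m, n)) : A^h^h = A.
Proof. by apply/matrixP => i j; rewrite !adjmxE conjcK. Qed.

Lemma adjmxD (R : realType) m n (A B : 'M[R[i]]_(m, n)) : (A + B)^h = A^h + B^h.
Proof. by rewrite /adjmx map_mxD linearD. Qed.

Lemma adjmxN (R : realType) m n (A : 'M[R[i]]_(m, n)) : (- A)^h = - A^h.
Proof. by rewrite /adjmx map_mxN linearN. Qed.

Lemma adjmxB (R : realType) m n (A B : 'M[R[i]]_(m, n)) : (A - B)^h = A^h - B^h.
Proof. by rewrite adjmxD adjmxN. Qed.

Lemma adjmxM (R : realType) m n p (A : 'M[R[i]]_(m, n)) (B : 'M[R[i]]_(n, p)) :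
  (A *m B)^h = B^h *m A^h.
Proof. by rewrite /adjmx map_mxM trmx_mul. Qed.

Lemma adjmxZ (R : realType) m n a (A : 'M[R[i]]_(m, n)) :
  (a *: A)^h = conjc a *: A^h.
Proof. by rewrite /adjmx map_mxZ linearZ. Qed.

Lemma adjmx_scalar (R : realType) n (a : R[i]) :
  (a%:M)^h = (conjc a)%:M :> 'M[R[i]]_n.
Proof. by rewrite /adjmx map_scalar_mx tr_scalar_mx. Qed.

Lemma adjmx1 (R : realType) n : (1%:M)^h = 1%:M :> 'M[R[i]]_n.
Proof. by rewrite adjmx_scalar conjc1. Qed.

Lemma adjmx0 (R : realType) m n : 0^h = 0 :> 'M[R[i]]_(m, n).
Proof. by rewrite /adjmx map_mx0 linear0. Qed.

Lemma adjmx_sum (R : realType) m n I (r : seq I) (P : pred I)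
    (F : I -> 'M[R[i]]_(m, n)) :
  (\sum_(i <- r | P i) F i)^h = \sum_(i <- r | P i) (F i)^h.
Proof.
exact: (big_morph (fun A => A^h) (@adjmxD R m n) (@adjmx0 R n m)).
Qed.

Lemma adjmx_inv (R : realType) n (A : 'M[R[i]]_n) : (invmx A)^h = invmx A^h.
Proof. by rewrite /adjmx map_invmx trmx_inv. Qed.

Lemma psd_gram (R : realType) m n (A : 'M[R[i]]_(m, n)) : psd (A^h *m A).
Proof.
move=> x; rewrite mulmxA -adjmxM -mulmxA mxE; apply: sumr_ge0 => k _.
by rewrite adjmxE mulrC mulcJ_ge0.
Qed.

Lemma psdD (R : realType) n (A B : 'M[R[i]]_n) : psd A -> psd B -> psd (A + B).
Proof. by move=> hA hB x; rewrite mulmxDr mulmxDl mxE addr_ge0. Qed.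

Lemma psdZ (R : realType) n (a : R) (A : 'M[R[i]]_n) :
  0 <= a -> psd A -> psd (a%:C%C *: A).
Proof. by move=> a0 hA x; rewrite -scalemxAr -scalemxAl mxE mulr_ge0 ?ler0c. Qed.

Lemma psd_congr (R : realType) m n (B : 'M[R[i]]_(m, n)) A :
  psd A -> psd (B^h *m A *m B).
Proof. by move=> hA x; have := hA (B *m x); rewrite adjmxM !mulmxA. Qed.

Lemma psd_scalar (R : realType) n (a : R) : 0 <= a -> psd (a%:C%C%:M : 'M[R[i]]_n).
Proof.
move=> a0; rewrite -scalemx1; apply: psdZ => //.
by rewrite -[1%:M]mulmx1 -{1}adjmx1; apply: psd_gram.
Qed.

Lemma gram_gt0 (R : realType) n (x : 'cV[R[i]]_n) :
  x != 0 -> 0 < (x^h *m x) 0 0.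
Proof.
move=> x0; have ge0 : forall i, true -> 0 <= x^h 0 i * x i 0.
  by move=> i _; rewrite adjmxE mulrC mulcJ_ge0.
rewrite mxE lt_neqAle sumr_ge0 // andbT eq_sym psumr_eq0 //.
apply: contra x0 => /allP h; apply/eqP/matrixP => i j; rewrite ord1 mxE.
have := h i (mem_index_enum _); rewrite adjmxE /= mulf_eq0 conjc_eq0 orbb.
by move/eqP.
Qed.

(** A kernel vector [x] would make the quadratic form of [A - e] equal to [- e |x|^2 < 0]. The
    explicit margin [e] expresses positive definiteness. *)
Lemma posdef_unit (R : realType) n (A : 'M[R[i]]_n) (e : R) :
  0 < e -> psd (A - e%:C%C%:M) -> A \in unitmx.
Proof.
move=> e0 hA; rewrite -unitmx_tr -row_free_unit -kermx_eq0.
apply/eqP/row_matrixP => i; rewrite row0.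
set r := row i _.
have rA : r *m A^T = 0 by rewrite /r -row_mul mulmx_ker row0.
have Ar : A *m r^T = 0 by rewrite -[A]trmxK -trmx_mul rA trmx0.
apply/eqP/negP => /negP r0.
have : 0 < (r^T^h *m r^T) 0 0 by apply: gram_gt0; rewrite trmx_eq0.
have := hA r^T; rewrite mulmxBr mulmxBl -mulmxA Ar mulmx0 sub0r -mulmxA.
rewrite mul_scalar_mx -scalemxAr.
rewrite !mxE oppr_ge0 => h1 h2; have := mulr_gt0 _ h2 => /(_ e%:C%C).
by rewrite ltcR => /(_ e0) /lt_le_trans /(_ h1); rewrite ltxx.
Qed.

(** * Krein extension and unitary completion *)

(** Chains of products are kept left-associated, where [A *m B] is not a subterm of [X *m A *m B];
    this form rewrites a known product there. *)
Lemma mulmx_subst (R : realType) m n p q (A : 'M[R[i]]_(n, p)) (B : 'M[R[i]]_(p, q))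
    C (X : 'M[R[i]]_(m, n)) :
  A *m B = C -> X *m A *m B = X *m C.
Proof. by rewrite -mulmxA => ->. Qed.

Lemma addmxE (R : realType) m n (A B : 'M[R[i]]_(m, n)) i j :
  (A + B) i j = A i j + B i j.
Proof. by rewrite !mxE. Qed.

Lemma oppmxE (R : realType) m n (A : 'M[R[i]]_(m, n)) i j : (- A) i j = - A i j.
Proof. by rewrite !mxE. Qed.

Lemma scalemxE (R : realType) m n a (A : 'M[R[i]]_(m, n)) i j :
  (a *: A) i j = a * A i j.
Proof. by rewrite !mxE. Qed.

Ltac mxexpand :=
  rewrite ?(mulmxDl, mulmxDr, mulNmx, mulmxN, =^~ scalemxAl, =^~ scalemxAr);
  rewrite ?mulmxA ?(scalerDr, scalerN, scalerA).

(* Generalizing the products first keeps [ring] from comparing them up to conversion. *)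
Ltac mxring :=
  repeat match goal with |- context [@mulmx ?R ?m ?n ?p ?A ?B] =>
    let X := fresh in set X := (@mulmx R m n p A B); clearbody X end;
  apply/matrixP => ? ?; rewrite ?(addmxE, oppmxE, scalemxE); ring.

(* Krein: in the decomposition of the space along the range of [S] and its complement, the first
   block column [X; Y] of [M] is prescribed, and the missing corner is taken to be
   [- Y X (t - X^2)^-1 Y^*].  In the proof, [P] is the part of [T] orthogonal to [S]. *)
Lemma hermitian_extension (R : realType) (N n : nat) (S T : 'M[R[i]]_(N, n)) (t e : R) :
  0 <= t -> 0 < e -> T^h *m S = S^h *m T ->
  psd (S^h *m S - e%:C%C%:M) ->
  psd (t%:C%C *: (S^h *m S) - T^h *m T - e%:C%C%:M) ->
  exists M : 'M[R[i]]_N,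
    [/\ M^h = M, M *m S = T & psd (t%:C%C%:M - M *m M)].
Proof.
move=> t0 e0 TS ha hc.
(* Abbreviations enter as variables with an equation, so that nothing unfolds unless rewritten. *)
have [a aE] : {a | a = S^h *m S} := exist _ _ erefl.
have [b bE] : {b | b = S^h *m T} := exist _ _ erefl.
rewrite -aE in ha hc.
have aU : a \in unitmx by apply: posdef_unit e0 ha.
have aH : a^h = a by rewrite aE adjmxM adjmxK.
have bH : b^h = b by rewrite bE adjmxM adjmxK.
have [ai aiE] : {X | X = invmx a} := exist _ _ erefl.
have aiH : ai^h = ai by rewrite aiE adjmx_inv aH.
have aai : a *m ai = 1%:M by rewrite aiE; apply: mulmxV.
have aia : ai *m a = 1%:M by rewrite aiE; apply: mulVmx.
have [P PE] : {X | X = T - S *m ai *m b} := exist _ _ erefl.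
have Ph : P^h = T^h - b *m ai *m S^h by rewrite PE adjmxB !adjmxM bH aiH mulmxA.
have SP : S^h *m P = 0.
  by rewrite PE mulmxBr !mulmxA -aE aai mul1mx -bE subrr.
have PS : P^h *m S = 0 by rewrite -[RHS]adjmx0 -SP adjmxM adjmxK.
have [q qE] : {X | X = P^h *m P} := exist _ _ erefl.
have qE' : q = T^h *m T - b *m ai *m b.
  rewrite qE {2}PE mulmxBr !mulmxA PS !mul0mx subr0 Ph mulmxBl.
  by rewrite -!mulmxA -bE.
(* For [X] the compression of [M] to the range of [S], [X S = S a^-1 b], so [c] is
   [S^* (t - X^2) S]. The norm bound on the prescribed column then reads [q <= c]. *)
have [c cE] : {X | X = t%:C%C *: a - b *m ai *m b} := exist _ _ erefl.
have cq : psd (c - q).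
  have -> : c - q = (t%:C%C *: a - T^h *m T - e%:C%C%:M) + e%:C%C%:M.
    rewrite qE' cE; mxring.
  apply: (psdD hc); apply: psd_scalar; exact: ltW.
have cU : c \in unitmx.
  apply: (posdef_unit e0).
  have -> : c - e%:C%C%:M = (t%:C%C *: a - T^h *m T - e%:C%C%:M) + q.
    rewrite qE' cE; mxring.
  rewrite qE; apply: (psdD hc); exact: psd_gram.
have cH : c^h = c.
  by rewrite cE adjmxB adjmxZ !adjmxM aH bH aiH conjc_real mulmxA.
have [k kE] : {X | X = invmx c} := exist _ _ erefl.
have kH : k^h = k by rewrite kE adjmx_inv cH.
have kc : k *m c = 1%:M by rewrite kE; apply: mulVmx.
have ck : c *m k = 1%:M by rewrite kE; apply: mulmxV.
(* The missing corner is [- P j P^*]. It is Hermitian because [X] commutes with [t - X^2], which is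
   [cab] in coordinates. *)
have [j jE] : {X | X = ai *m b *m k} := exist _ _ erefl.
have cab : c *m ai *m b = b *m ai *m c.
  rewrite cE; mxexpand.
  by rewrite aai mul1mx (mulmx_subst _ aia) mulmx1.
have cj : c *m j = b *m ai.
  by rewrite jE !mulmxA cab (mulmx_subst _ ck) mulmx1.
have jH : j^h = j.
  rewrite jE !adjmxM kH bH aiH.
  by rewrite -jE -[RHS]mul1mx -kc -mulmxA cj mulmxA.
have jc : j *m c = ai *m b by rewrite jE (mulmx_subst _ kc) mulmx1.
have [F FE] : {X | X = b *m ai *m S^h + P^h} := exist _ _ erefl.
have [G GE] : {X | X = ai *m S^h - j *m P^h} := exist _ _ erefl.
have Fh : F^h = S *m ai *m b + P by rewrite FE adjmxD !adjmxM !adjmxK bH aiH mulmxA.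
have Gh : G^h = S *m ai - P *m j by rewrite GE adjmxB !adjmxM !adjmxK jH aiH.
have [M ME] : {X | X = S *m ai *m F + P *m G} := exist _ _ erefl.
have MH : M^h = M.
  rewrite ME adjmxD !adjmxM Fh Gh aiH; rewrite FE GE; mxexpand.
  mxring.
have MS : M *m S = T.
  rewrite ME FE GE; mxexpand.
  rewrite !(mulmx_subst _ PS) !mulmx0 oppr0 !addr0.
  rewrite !(mulmx_subst _ (esym aE)).
  by rewrite !(mulmx_subst _ aia) !mulmx1 PE addrC subrK.
exists M; split => //.
have MM : M *m M = F^h *m ai *m F + G^h *m q *m G.
  rewrite -{1}MH ME adjmxD !adjmxM aiH; mxexpand.
  rewrite !(mulmx_subst _ PS) !(mulmx_subst _ SP) !mulmx0 !mul0mx.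
  rewrite !(mulmx_subst _ (esym aE)) !(mulmx_subst _ aia) !mulmx1.
  by rewrite addr0 add0r qE mulmxA.
(* Compare [MM], which has [q] in place of [c]. Were they equal, [M^2] would be [t] times a
   projection; in general the defect is [t L + G^* (c - q) G], with [L] below. *)
have FG : F^h *m ai *m F + G^h *m c *m G
    = t%:C%C *: (S *m ai *m S^h + P *m k *m P^h).
  have caic : ai *m c *m ai = t%:C%C *: ai - ai *m b *m ai *m b *m ai.
    by rewrite cE; mxexpand; rewrite aia mul1mx.
  have abj : ai *m b *m j = t%:C%C *: k - ai.
    rewrite jE !mulmxA.
    have -> : ai *m b *m ai *m b *m k = ai *m (t%:C%C *: a - c) *m k.
      by rewrite cE opprB addrC subrK !mulmxA.
    mxexpand; rewrite aia mul1mx (mulmx_subst _ ck) mulmx1; mxring.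
  rewrite Fh Gh FE GE; mxexpand.
  rewrite !(mulmx_subst _ jc) !(mulmx_subst _ cj).
  have -> : S *m ai *m c *m ai *m S^h = S *m (ai *m c *m ai) *m S^h by rewrite !mulmxA.
  have -> : P *m (ai *m b) *m j *m P^h = P *m (ai *m b *m j) *m P^h by rewrite !mulmxA.
  rewrite caic abj; mxexpand; mxring.
(* [L >= 0] because [q <= c] makes [P c^-1 P^*] a contraction living orthogonally to the range of
   [S]; [LL] makes this explicit. *)
have [L LE] : {X | X = 1%:M - S *m ai *m S^h - P *m k *m P^h} := exist _ _ erefl.
have Lh : L^h = L by rewrite LE !adjmxB adjmx1 !adjmxM !adjmxK aiH kH !mulmxA.
have LL : L = L^h *m L + (k *m P^h)^h *m (c - q) *m (k *m P^h).
  rewrite Lh adjmxM adjmxK kH LE qE; mxexpand.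
  rewrite !(mulmx_subst _ PS) !(mulmx_subst _ SP) !mulmx0 !mul0mx.
  rewrite !(mulmx_subst _ (esym aE)) !(mulmx_subst _ aia).
  rewrite !(mulmx_subst _ kc) !mulmx1 !mul1mx.
  rewrite !oppr0 !addr0; mxring.
have -> : t%:C%C%:M - M *m M = t%:C%C *: L + G^h *m (c - q) *m G.
  have -> : G^h *m (c - q) *m G = G^h *m c *m G - G^h *m q *m G by mxexpand.
  rewrite MM -scalemx1.
  have -> : G^h *m c *m G = t%:C%C *: (S *m ai *m S^h + P *m k *m P^h) - F^h *m ai *m F.
    by rewrite -FG addrC addKr.
  rewrite LE; mxring.
apply: psdD; last exact: psd_congr.
apply: psdZ => //; rewrite LL; apply: psdD; first exact: psd_gram.
exact: psd_congr.
Qed.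

Lemma conjc_i (R : realType) : conjc 'i%C = - 'i%C :> R[i].
Proof. by apply/eqP; rewrite eq_complex /= oppr0 !eqxx. Qed.

(** An eigenvalue [tan (x / 2)] of [M] becomes [e^(i x)], and for [mu = cos c] the number
    [(1 - mu) / (1 + mu)] is [tan^2 (c / 2)]. With [Z = 1 - iM] and [U = Z^-1 Z^*], congruence by
    [Z^-1] carries [2 (1 + mu)] times the assumed positive matrix to [U + U^* - 2 mu]. *)
Lemma cayley_unitary (R : realType) (N : nat) (M : 'M[R[i]]_N) (mu : R) :
  -1 < mu -> M^h = M -> psd (((1 - mu) / (1 + mu))%:C%C%:M - M *m M) ->
  exists U : 'M[R[i]]_N,
    [/\ Defs.unitarymx U, psd (U + U^h - (2 * mu)%:C%C%:M) &
        forall n (E V : 'M[R[i]]_(N, n)),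
          M *m (V + E) = - 'i%C *: (V - E) -> U *m E = V].
Proof.
move=> mu1 MH Mt.
have ii : 'i%C * 'i%C = -1 :> R[i] by rewrite -expr2 sqr_i.
have [Z ZE] : {X | X = 1%:M - 'i%C *: M} := exist _ _ erefl.
have Zh : Z^h = 1%:M + 'i%C *: M.
  by rewrite ZE adjmxB adjmxZ adjmx1 MH conjc_i scaleNr opprK.
have ZZ : Z *m Z^h = 1%:M + M *m M.
  rewrite Zh ZE; mxexpand; rewrite !mul1mx !mulmx1.
  by rewrite ii; mxring.
have ZZh : Z^h *m Z = 1%:M + M *m M.
  rewrite Zh ZE; mxexpand; rewrite !mul1mx !mulmx1.
  by rewrite ii; mxring.
have ZZU : Z *m Z^h \in unitmx.
  apply: (posdef_unit (e := 1) ltr01).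
  by rewrite ZZ addrC addKr -{1}MH; apply: psd_gram.
have ZU : Z \in unitmx by move: ZZU; rewrite unitmx_mul => /andP[].
have [W WE] : {X | X = invmx Z} := exist _ _ erefl.
have WZ : W *m Z = 1%:M by rewrite WE mulVmx.
have ZW : Z *m W = 1%:M by rewrite WE mulmxV.
have ZWh : Z^h *m W^h = 1%:M by rewrite -adjmxM WZ adjmx1.
exists (W *m Z^h); split.
- rewrite /Defs.unitarymx adjmxM adjmxK !mulmxA (mulmx_subst _ ZZh) -ZZ !mulmxA WZ.
  by rewrite mul1mx ZWh.
  - have -> : W *m Z^h + (W *m Z^h)^h - (2 * mu)%:C%C%:M
      = W^h^h *m ((2 * (1 + mu))%:C%C *: (((1 - mu) / (1 + mu))%:C%C%:M - M *m M)) *m W^h.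
    have -> : (2 * (1 + mu))%:C%C *: (((1 - mu) / (1 + mu))%:C%C%:M - M *m M)
        = Z^h *m Z^h + Z *m Z - (2 * mu)%:C%C *: (Z *m Z^h).
      rewrite ZZ Zh ZE; mxexpand; rewrite !mul1mx !mulmx1.
      rewrite -[_%:C%C%:M]scalemx1 scalerA -rmorphM /=.
      have -> : 2 * (1 + mu) * ((1 - mu) / (1 + mu)) = 2 - 2 * mu by field; lra.
      rewrite !ii.
      rewrite !(rmorphB, rmorphD, rmorphM, rmorph1, rmorph_nat) /=; mxring.
      rewrite adjmxK; mxexpand.
      rewrite !(mulmx_subst _ ZWh) !mulmx1 !WZ mul1mx scalemx1.
    by rewrite adjmxM adjmxK.
  apply/psd_congr/psdZ => //; lra.
move=> n E V h; rewrite -mulmxA.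
(* This is the hypothesis on [M] multiplied by [i] and rearranged. *)
suff -> : Z^h *m E = Z *m V by rewrite mulmxA WZ mul1mx.
have := congr1 (fun X => 'i%C *: X) h; rewrite scalerA mulrN ii opprK scale1r mulmxDr.
move=> h'; apply/eqP; rewrite -subr_eq0; apply/eqP.
rewrite -(subrr (V - E)) -{1}h' Zh ZE; mxexpand; rewrite !mul1mx; mxring.
Qed.

(* The Cayley transform sends the partial isometry [E x |-> V x] to the symmetric partial map
   [(V + E) x |-> - i (V - E) x]. *)
Lemma unitary_completion (R : realType) (N n : nat) (E V : 'M[R[i]]_(N, n)) (mu e : R) :
  -1 < mu -> mu <= 1 -> 0 < e -> E^h *m E = 1%:M -> V^h *m V = 1%:M ->
  psd (E^h *m V + (E^h *m V)^h - (2 * mu + e)%:C%C%:M) ->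
  exists U : 'M[R[i]]_N,
    [/\ Defs.unitarymx U, U *m E = V & psd (U + U^h - (2 * mu)%:C%C%:M)].
Proof.
move=> mu1 mu2 e0 EE VV; rewrite adjmxM adjmxK.
move HE : (E^h *m V + _) => H hH.
have [t tE] : {x | x = (1 - mu) / (1 + mu)} := exist _ _ erefl.
have [S SE] : {X | X = V + E} := exist _ _ erefl.
have [T TE] : {X | X = - 'i%C *: (V - E)} := exist _ _ erefl.
have Ni : conjc (- 'i%C) = 'i%C :> R[i] by rewrite -conjc_i conjcK.
have SS : S^h *m S = 2%:M + H.
  rewrite SE adjmxD; mxexpand; rewrite EE VV -HE -[2%:M]scalemx1; mxring.
have TT : T^h *m T = 2%:M - H.
  rewrite TE adjmxZ adjmxB Ni; mxexpand; rewrite EE VV -HE -[2%:M]scalemx1.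
  rewrite ?opprK mulrN -expr2 sqr_i; mxring.
have TS : T^h *m S = S^h *m T.
  rewrite TE SE adjmxZ Ni -scalemxAl -scalemxAr scaleNr -scalerN adjmxB adjmxD.
  congr (_ *: _); rewrite !(mulmxDl, mulmxDr, mulNmx, mulmxN) EE VV.
  mxring.
have t0 : 0 <= t by rewrite tE; apply: divr_ge0; lra.
have [] := @hermitian_extension _ _ _ S T t e t0 e0 TS.
- have -> : S^h *m S - e%:C%C%:M = (H - (2 * mu + e)%:C%C%:M) + (2 + 2 * mu)%:C%C%:M.
      rewrite SS -[2%:M]scalemx1 -[e%:C%C%:M]scalemx1.
    rewrite -[(2 * mu + e)%:C%C%:M]scalemx1 -[(2 + 2 * mu)%:C%C%:M]scalemx1.
      rewrite !(rmorphD, rmorphM, rmorph_nat) /=; mxring.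
  by apply: psdD => //; apply: psd_scalar; lra.
- have -> : t%:C%C *: (S^h *m S) - T^h *m T - e%:C%C%:M
      = (1 + t)%:C%C *: (H - (2 * mu + e)%:C%C%:M) + (t * e)%:C%C%:M.
    (* By this identity [t (2 + H) - (2 - H) = (1 + t) (H - 2 mu)], so the margin [e] of [H]
       survives. *)
    have tmu : 1 - t = mu * (1 + t) by rewrite tE; field; lra.
      have /(congr1 (fun x => x%:C%C)) : (1 + t) * (2 * mu + e) = 2 - 2 * t + e + t * e by lra.
      rewrite SS TT -[2%:M]scalemx1 -[e%:C%C%:M]scalemx1.
    rewrite -[(2 * mu + e)%:C%C%:M]scalemx1 -[(t * e)%:C%C%:M]scalemx1.
    rewrite scalerBr scalerA -rmorphM /= => ->.
      rewrite !(rmorphD, rmorphB, rmorphM, rmorph_nat, rmorph1) /=; mxring.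
    apply: psdD; first by apply: psdZ => //; lra.
  by apply: psd_scalar; rewrite mulr_ge0 // ltW.
rewrite tE => M [MH MST Mt].
have [U [UU Umu UEV]] := cayley_unitary mu1 MH Mt.
by exists U; split => //; apply: UEV; rewrite -SE -TE.
Qed.

(** * Spectral bounds *)

Lemma psd_diag (R : realType) n (d : 'rV[R[i]]_n) :
  (forall i, 0 <= d 0 i) -> psd (diag_mx d).
Proof.
move=> d0 x; rewrite mul_mx_diag mxE; apply: sumr_ge0 => k _.
by rewrite !mxE mulrAC mulr_ge0 // mulrC mulcJ_ge0.
Qed.

(** The spectral theorem turns a bound on the real parts of eigenvalues into an operator inequality,
    for Hermitian and unitary [A] alike. *)
Lemma normal_diagonalization (R : realType) n (A : 'M[R[i]]_n) :
  A *m A^h = A^h *m A ->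
  exists d : 'rV[R[i]]_n,
    (forall i, spectrum A (d 0 i)) /\
    forall s : R, (forall i, s <= complex.Re (d 0 i)) ->
      psd (A + A^h - (2 * s)%:C%C%:M).
Proof.
have adjE m (B : 'M[R[i]]_m) : B^h = (map_mx Num.conj (B^T)) by rewrite /adjmx map_trmx.
move=> AA.
have /orthomx_spectralP AE : A \is normalmx by apply/normalmxP; rewrite -!adjE.
have PU := spectral_unitarymx A.
have PP : spectralmx A \in unitmx by apply: spectral_unit.
move: AE PU PP; set P := spectralmx A; set d := spectral_diag A => AE PU PP.
rewrite invmx_unitary // -adjE in AE.
have PPh : P *m P^h = 1%:M by rewrite adjE; apply/unitarymxP.
have PhP : P^h *m P = 1%:M by apply: mulmx1C.
clearbody P d; exists d; split.
  move=> i; apply/eigenvalueP; exists (row i P).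
    rewrite -row_mul AE !mulmxA PPh mul1mx; apply/rowP => j.
    by rewrite mul_diag_mx !mxE.
  apply/eqP => Pi0; move/(congr1 (row i)): PPh.
  rewrite row_mul Pi0 mul0mx => /matrixP/(_ 0 i); rewrite !mxE eqxx.
  by move/esym/eqP; rewrite oner_eq0.
move=> s sd.
have -> : A + A^h - (2 * s)%:C%C%:M
    = P^h *m (diag_mx (d + map_mx (@conjc R) d - const_mx (2 * s)%:C%C)) *m P.
  have -> : diag_mx (d + map_mx (@conjc R) d - const_mx (2 * s)%:C%C)
     = diag_mx d + (diag_mx d)^h - (2 * s)%:C%C *: 1%:M.
    rewrite scalemx1 -diag_const_mx /adjmx map_diag_mx tr_diag_mx.
    by rewrite linearB linearD.
  rewrite {1 2}AE !adjmxM adjmxK; mxexpand; rewrite mulmx1 PhP scalemx1.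
  by [].
apply/psd_congr/psd_diag => i; rewrite !mxE addcJ.
rewrite lecE /=; move: (sd i).
case: (d 0 i) => x y /= h; apply/andP; split; [|lra].
by apply/eqP; ring.
Qed.

Lemma re_eigenvalue_ge (R : realType) n (A : 'M[R[i]]_n) (s : R) (a : R[i]) :
  psd (A + A^h - (2 * s)%:C%C%:M) -> spectrum A a -> s <= complex.Re a.
Proof.
move=> hA /eigenvalueP[v vA v0].
have v0' : v^h != 0 by apply: contra v0 => /eqP h; rewrite -[v]adjmxK h adjmx0.
have := gram_gt0 v0'; rewrite adjmxK => vv.
have := hA v^h; rewrite adjmxK mulmxBr mulmxBl mulmxDr mulmxDl vA.
have -> : v *m A^h *m v^h = conjc a *: (v *m v^h).
  by rewrite -mulmxA -adjmxM vA adjmxZ -scalemxAr.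
rewrite -scalemxAl mul_mx_scalar -scalemxAl -scalerDl -scalerBl addcJ.
rewrite scalemxE pmulr_lge0 //.
case: a vA => x y _ /=; rewrite lecE /= => /andP[_].
lra.
Qed.

Lemma spectrum_nonempty (R : realType) n (A : 'M[R[i]]_n) :
  (0 < n)%N -> exists a, spectrum A a.
Proof. exact: eigenvalue_closed. Qed.

(** Rayleigh's characterisation trades an infimum over the spectrum for an inequality that is
    real-linear in [B]. For [n = 0] the infimum would be the default value 0. *)
Lemma lambda_minP (R : realType) n (B : 'M[R[i]]_n) (s : R) :
  (0 < n)%N ->
  s <= lambda_min (B + B^h) / 2 <-> psd (B + B^h - (2 * s)%:C%C%:M).
Proof.
move=> n0; set H := B + B^h.
have HH : H^h = H by rewrite /H adjmxD adjmxK addrC.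
have psd2 (r : R) : psd (H + H^h - (2 * r)%:C%C%:M) <-> psd (H - r%:C%C%:M).
  have E : H + H^h - (2 * r)%:C%C%:M = 2%:C%C *: (H - r%:C%C%:M).
    rewrite HH -[(2 * r)%:C%C%:M]scalemx1 -[r%:C%C%:M]scalemx1 rmorphM rmorph_nat.
    mxring.
  split => h; last by rewrite E; apply: psdZ.
  have -> : H - r%:C%C%:M = (2^-1)%:C%C *: (H + H^h - (2 * r)%:C%C%:M).
    by rewrite E scalerA -rmorphM mulVf ?pnatr_eq0 // rmorph1 scale1r.
  by apply: psdZ => //; rewrite invr_ge0.
have [d [dsp dpsd]] := normal_diagonalization (congr2 mulmx (esym HH) HH).
have [a0 a0H] := spectrum_nonempty H n0.
rewrite ler_pdivlMr // [s * 2]mulrC; split => [h|h].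
  case: (psd2 (2 * s)) => k _; apply k.
  apply: (dpsd _) => i.
  apply: (le_trans h); apply: ge_inf; last first.
    by exists (d 0 i); [exact: dsp|].
  (* The infimum needs some lower bound. The operator inequality gives one for every eigenvalue,
     without showing that [d] exhausts the spectrum. *)
  exists (- \sum_i `|complex.Re (d 0 i)|) => _ [a aH <-].
  apply: re_eigenvalue_ge aH; apply: dpsd => j.
  rewrite lerNl; apply: le_trans (_ : `|complex.Re (d 0 j)| <= _).
    by rewrite -normrN ler_norm.
  by rewrite (bigD1 j) //= lerDl sumr_ge0.
apply: lb_le_inf; first by exists (complex.Re a0); exists a0; [exact: a0H|].
move=> _ [a aH <-]; apply: re_eigenvalue_ge aH.
case: (psd2 (2 * s)) => _ k; exact (k h).
Qed.

(** * The cost of a unitary *)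

Lemma ler_cos_pi (R : realType) (x y : R) :
  0 <= x <= pi -> 0 <= y <= pi -> (cos x <= cos y) = (y <= x).
Proof. by move=> hx hy; rewrite !leNgt ltr_cos // in_itv. Qed.

Lemma unit_circle_polar (R : realType) (x y : R) :
  x ^+ 2 + y ^+ 2 = 1 -> exists t : R, [/\ - pi < t <= pi, cos t = x & sin t = y].
Proof.
move=> xy; have x1 : -1 <= x <= 1.
  rewrite -ler_norml -(@expr_le1 _ 2) // real_normK ?num_real //.
  by have := sqr_ge0 y; lra.
have [/andP[a0 api] ca] := acos_def x1.
have sa : sin (acos x) = `|y|.
  by rewrite sin_acos // -xy addrAC subrr add0r sqrtr_sqr.
have [y0|y0] := lerP 0 y.
  exists (acos x); split; rewrite ?sa ?ger0_norm //.
  by rewrite api andbT (lt_le_trans _ a0) // oppr_lt0 pi_gt0.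
(* The angle must stay above [- pi]: [x = -1] would force [y = 0]. *)
exists (- acos x); split; last by rewrite sinN sa ltr0_norm ?opprK.
  rewrite ltrN2 (le_trans _ (pi_ge0 R)) ?oppr_le0 // andbT.
  rewrite acos_ltpi //; have : 0 < y ^+ 2 by rewrite exprn_even_gt0 //= lt_eqF.
  case/andP: x1 => x1 x2 y2; rewrite x2 andbT lt_neqAle x1 andbT.
  by apply: contraTneq y2 => xE; move: xy; rewrite -xE; nra.
by rewrite cosN.
Qed.

Lemma unitary_cost_le (R : realType) n (U : 'M[R[i]]_n) (c : R) :
  0 <= c <= pi -> psd (U + U^h - (2 * cos c)%:C%C%:M) -> unitary_cost U <= c.
Proof.
move=> c0 hU; rewrite /unitary_cost; set S := (X in sup X).
(* The supremum of an empty set is 0 by convention, and [0 <= c]. *)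
have [S0|S0] := pselect (S !=set0)%classic; last first.
  rewrite sup_out; last by case.
  by case/andP: c0.
apply: ge_sup => // _ [t [/andP[t1 t2] ht] <-].
have tpi : 0 <= `|t| <= pi by rewrite normr_ge0 ler_norml (ltW t1) t2.
rewrite -ler_cos_pi // cos_norm.
exact: (re_eigenvalue_ge hU ht).
Qed.

(** Eigenvalues of [U] lie on the unit circle, so each is [e^(i t)] with [|t|] at most the cost and
    real part at least its cosine. Normality of [U] lifts this to an operator inequality. *)
Lemma unitary_cost_psd (R : realType) n (U : 'M[R[i]]_n) :
  (0 < n)%N -> Defs.unitarymx U ->
  0 <= unitary_cost U <= pi /\
  psd (U + U^h - (2 * cos (unitary_cost U))%:C%C%:M).
Proof.
move=> n0 UU.
have UU' : U^h *m U = 1%:M by apply: mulmx1C.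
have polar a : spectrum U a -> exists t : R, - pi < t <= pi /\ a = (cos t +i* sin t)%C.
  move=> /eigenvalueP[v vU v0].
  have v0' : v^h != 0 by apply: contra v0 => /eqP h; rewrite -[v]adjmxK h adjmx0.
  have := gram_gt0 v0'; rewrite adjmxK => vv.
  have : (v *m U) *m (v *m U)^h = v *m v^h.
    by rewrite adjmxM mulmxA -[v *m U *m _]mulmxA UU mulmx1.
  rewrite vU adjmxZ -scalemxAl -scalemxAr scalerA => /matrixP/(_ 0 0).
  rewrite scalemxE -[RHS]mul1r => /(mulIf (lt0r_neq0 vv)).
  rewrite -sqr_normc -add_Re2_Im2 => -[] /unit_circle_polar[t [t1 t2 t3]].
  by exists t; split => //; rewrite t2 t3; case: (a).
have ubd : has_ubound [set `|t| | t in [set t : R | - pi < t <= pi /\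
                         spectrum U ((cos t) +i* (sin t))%C]]%classic.
  by exists pi => _ [t [/andP[t1 t2] _] <-]; rewrite ler_norml (ltW t1) t2.
have ub t : - pi < t <= pi -> spectrum U (cos t +i* sin t)%C -> `|t| <= unitary_cost U.
  move=> ht hU; apply: (ub_le_sup ubd); exists t; [split; [exact: ht|exact: hU]|by []].
have [a ha] := spectrum_nonempty U n0.
have [t [ht aE]] := polar a ha; rewrite aE in ha.
have c0 : 0 <= unitary_cost U by apply: le_trans (ub t ht ha); rewrite normr_ge0.
have cpi : unitary_cost U <= pi.
  apply: ge_sup; first by exists `|t|; exists t; [split; [exact: ht|exact: ha]|].
  by move=> _ [u [/andP[t1 t2] _] <-]; rewrite ler_norml (ltW t1) t2.
split; first by rewrite c0.
have [d [dU hd]] := normal_diagonalization (etrans UU (esym UU')).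
apply: (hd _) => i; have [u [hu dE]] := polar _ (dU i).
have cB : 0 <= unitary_cost U <= pi by rewrite c0.
have uB : 0 <= `|u| <= pi.
  by case/andP: hu => t1 t2; rewrite normr_ge0 ler_norml (ltW t1) t2.
rewrite dE /= -[cos u]cos_norm (ler_cos_pi cB uB).
by apply: (ub _ hu); rewrite -dE; apply: dU.
Qed.

(** * Dilations and Kraus operators *)

Definition blockB {R : realType} {mB n p} (V : 'M[R[i]]_(mB * n, p)) (b : 'I_mB) :
  'M[R[i]]_(n, p) := \matrix_(a, a') V (mxtens_index (b, a)) a'.

Definition stackB {R : realType} {mB n p} (F : 'I_mB -> 'M[R[i]]_(n, p)) :
  'M[R[i]]_(mB * n, p) :=
  \matrix_(i, a') F (mxtens_unindex i).1 (mxtens_unindex i).2 a'.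

(** The isometry [x |-> |0> tensor x], the embedding [E] of the outline. *)
Definition ket0I {R : realType} m n : 'M[R[i]]_(m.+1 * n, n) :=
  stackB (fun b => if b == 0 then 1%:M else 0).

Lemma stackBK (R : realType) mB n p (F : 'I_mB -> 'M[R[i]]_(n, p)) b :
  blockB (stackB F) b = F b.
Proof. by apply/matrixP => a a'; rewrite !mxE mxtens_indexK. Qed.

Lemma mulmx_blockB (R : realType) mB n p q (V : 'M[R[i]]_(mB * n, p))
    (W : 'M[R[i]]_(mB * n, q)) :
  V^h *m W = \sum_b (blockB V b)^h *m blockB W b.
Proof.
apply/matrixP => i j; rewrite mxE summxE.
rewrite (reindex (@mxtens_index mB n)) /=; last first.
  by exists (@mxtens_unindex mB n) => k _; rewrite (mxtens_indexK, mxtens_unindexK).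
transitivity (\sum_b \sum_a V^h i (mxtens_index (b, a)) * W (mxtens_index (b, a)) j).
  by rewrite pair_bigA; apply: eq_bigr => -[].
by apply: eq_bigr => b _; rewrite mxE; apply: eq_bigr => a _; rewrite !mxE.
Qed.

Lemma ptraceB_blockB (R : realType) mB n (V : 'M[R[i]]_(mB * n, n)) (rho : 'M[R[i]]_n) :
  ptraceB (V *m rho *m V^h) = \sum_b blockB V b *m rho *m (blockB V b)^h.
Proof.
apply/matrixP => a a'; rewrite mxE summxE; apply: eq_bigr => b _.
rewrite !mxE; apply: eq_bigr => k _; rewrite !mxE; congr (_ * _).
by apply: eq_bigr => l _; rewrite !mxE.
Qed.

Lemma ket0I_mul (R : realType) m n p (V : 'M[R[i]]_(m.+1 * n, p)) :
  (ket0I m n)^h *m V = blockB V 0.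
Proof.
rewrite mulmx_blockB (bigD1 0) //= big1 ?addr0; last first.
  by move=> b b0; rewrite stackBK (negbTE b0) adjmx0 mul0mx.
by rewrite stackBK eqxx adjmx1 mul1mx.
Qed.

Lemma ket0bra0_tens (R : realType) m n (rho : 'M[R[i]]_n) :
  ket0bra0 R m *t rho = ket0I m n *m rho *m (ket0I m n)^h.
Proof.
have rowE (q : nat) (X : 'M[R[i]]_(n, q)) i k : (ket0I m n *m X) i k
    = ((mxtens_unindex i).1 == 0)%:R * X (mxtens_unindex i).2 k.
  rewrite mxE (bigD1 (mxtens_unindex i).2) //= big1 ?addr0.
    by rewrite !mxE; case: eqP => _; rewrite !mxE ?eqxx.
  move=> l li; rewrite !mxE; case: eqP => _; rewrite !mxE ?mul0r //.
  by rewrite eq_sym (negbTE li) mul0r.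
apply/matrixP => i j; rewrite -mulmxA rowE -[_ *m _^h]adjmxK adjmxE adjmxM adjmxK.
rewrite rowE adjmxE rmorphM /= conjcK /tensmx mxE mxE mulrA; congr (_ * _).
rewrite -[ord0]/(0 : 'I_m.+1) rmorph_nat -natrM mulnb.
by [].
Qed.

(** Since [|0><0| tensor rho = E rho E^*], only the first block column [U E] matters, and its blocks
    act as Kraus operators. *)
Lemma dilatesE (R : realType) m n (Kc : 'M[R[i]]_n -> 'M[R[i]]_n)
    (U : 'M[R[i]]_(m.+1 * n)) :
  dilates Kc U <-> Defs.unitarymx U /\ forall rho, density rho ->
    Kc rho = kraus_channel (blockB (U *m ket0I m n)) rho.
Proof.
have E rho : ptraceB (U *m (ket0bra0 R m *t rho) *m U^h)
    = kraus_channel (blockB (U *m ket0I m n)) rho.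
  by rewrite ket0bra0_tens /kraus_channel -ptraceB_blockB adjmxM !mulmxA.
by split=> -[UU h]; split=> // rho /h; rewrite E.
Qed.

Lemma gram_eq0 (R : realType) m n (X : 'M[R[i]]_(m, n)) : X^h *m X = 0 -> X = 0.
Proof.
move=> XX; apply/matrixP => i j.
suff /matrixP/(_ i 0) : col j X = 0 by rewrite !mxE.
apply/eqP/negPn/negP => /gram_gt0.
suff -> : ((col j X)^h *m col j X) 0 0 = (X^h *m X) j j by rewrite XX mxE ltxx.
by rewrite !mxE; apply: eq_bigr => k _; rewrite !mxE.
Qed.

(* The witness [v] is the minimal-norm solution: it lies in the row space of [A^*], and
   Cauchy-Schwarz bounds its squared norm [nu] by [nu^2 <= nu]. *)
Lemma gram_row_combination (R : realType) d m N (A : 'M[R[i]]_(d, N))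
    (B : 'M[R[i]]_(m, N)) i :
  A^h *m A = B^h *m B ->
  exists v : 'rV[R[i]]_d, row i B = v *m A /\ (v *m v^h) 0 0 <= 1.
Proof.
move=> AB; have /submxP[z zE] : (row i B <= A^h *m A)%MS.
  rewrite submxE -row_mul; set C := cokermx _.
  (* [C] is annihilated by [A^* A = B^* B], so [B C] has zero Gram matrix. *)
  suff -> : B *m C = 0 by rewrite row0.
  apply: gram_eq0; rewrite adjmxM -mulmxA [B^h *m _]mulmxA -AB mulmx_coker.
  by rewrite mulmx0.
exists (z *m A^h); rewrite -mulmxA; split => //.
set nu := (X in X <= 1).
have nuE : nu = (row i B *m z^h) 0 0 by rewrite /nu zE adjmxM adjmxK !mulmxA.
have nu0 : 0 <= nu by rewrite /nu -{1}[z *m _]adjmxK mxE sumr_ge0 // => k _;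
  rewrite !adjmxE mulrC mulcJ_ge0.
have nuB : nu = ((B *m z^h)^h *m (B *m z^h)) 0 0.
  by rewrite adjmxM adjmxK -mulmxA [B^h *m _]mulmxA -AB /nu adjmxM adjmxK !mulmxA.
(* [nu] is entry [i] of the vector [B z^*], whose squared norm is also [nu]. *)
have : nu * nu <= nu.
  rewrite [leRHS]nuB mxE (bigD1 i) //=.
  have Bnu : (B *m z^h) i 0 = nu.
    by rewrite nuE !mxE; apply: eq_bigr => k _; rewrite !mxE.
  rewrite adjmxE Bnu.
  have -> : conjc nu = nu by apply/CrealP/ger0_real.
  by rewrite lerDl sumr_ge0 // => k _; rewrite adjmxE mulrC mulcJ_ge0.
have [->|n0] := eqVneq nu 0; first by rewrite ler01.
by rewrite -[leRHS]mulr1 ler_pM2l // lt_neqAle eq_sym n0.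
Qed.

Lemma vnorm_le1 (R : realType) d (v : 'I_d -> R[i]) :
  (vnorm v <= 1) = (\sum_j v j * conjc (v j) <= 1).
Proof.
have -> : \sum_j v j * conjc (v j)
    = (\sum_j (complex.Re (v j) ^+ 2 + complex.Im (v j) ^+ 2))%:C%C.
  by rewrite rmorph_sum; apply: eq_bigr => j _; rewrite /= add_Re2_Im2 sqr_normc.
rewrite -[X in _ = (_ <= X)](rmorph1 (real_complex R)) lecR /vnorm.
by rewrite -{1}[1]sqrtr1 ler_sqrt ?ltr01.
Qed.

Lemma density_rank1 (R : realType) n (x : 'cV[R[i]]_n) :
  x != 0 -> density (((x^h *m x) 0 0)^-1 *: (x *m x^h)).
Proof.
move=> x0; have := gram_gt0 x0; set a := (_ *m _) 0 0 => a0.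
have ainv : 0 <= a^-1 by rewrite invr_ge0 ltW.
split; first last; [split|].
- move=> y; rewrite -scalemxAr -scalemxAl scalemxE mulr_ge0 //.
  by have := @psd_gram _ _ _ (x^h) y; rewrite adjmxK.
- rewrite mxtraceZ mxtrace_mulC /mxtrace big_ord_recl big_ord0 addr0 -/a.
  by rewrite mulVf // lt0r_neq0.
- rewrite /Defs.hermitian adjmxZ adjmxM adjmxK; congr (_ *: _).
  by apply/CrealP/ger0_real.
Qed.

(** Agreement on density matrices covers the multiples of pure states [u u^*]; polarization over
    [x + y] and [x + i y] then reaches all [x y^*], hence the matrix units. *)
Lemma kraus_polarization (R : realType) n d m (K : 'I_d -> 'M[R[i]]_n)
    (F : 'I_m -> 'M[R[i]]_n) :
  (forall rho, density rho -> kraus_channel K rho = kraus_channel F rho) ->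
  forall x y : 'cV[R[i]]_n, kraus_channel K (x *m y^h) = kraus_channel F (x *m y^h).
Proof.
move=> KF.
have kD p (G : 'I_p -> 'M[R[i]]_n) A B :
    kraus_channel G (A + B) = kraus_channel G A + kraus_channel G B.
  by rewrite /kraus_channel -big_split; apply: eq_bigr => j _ /=; rewrite mulmxDr mulmxDl.
have kZ p (G : 'I_p -> 'M[R[i]]_n) a A :
    kraus_channel G (a *: A) = a *: kraus_channel G A.
  by rewrite /kraus_channel scaler_sumr; apply: eq_bigr => j _ /=;
    rewrite -scalemxAr -scalemxAl.
have diag (x : 'cV[R[i]]_n) : kraus_channel K (x *m x^h) = kraus_channel F (x *m x^h).
  have [->|x0] := eqVneq x 0.
    by rewrite mul0mx /kraus_channel !big1 // => j _; rewrite mulmx0 mul0mx.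
  have := KF _ (density_rank1 x0); rewrite !kZ => /scalerI; apply.
  by rewrite invr_eq0 lt0r_neq0 // gram_gt0.
move=> x y.
have [D DE] : exists D, forall A, D A = kraus_channel K A - kraus_channel F A.
  by exists (fun A => kraus_channel K A - kraus_channel F A).
have DD A B : D (A + B) = D A + D B by rewrite !DE !kD; mxring.
have DZ a A : D (a *: A) = a *: D A by rewrite !DE !kZ scalerBr.
have D0 (u : 'cV[R[i]]_n) : D (u *m u^h) = 0 by rewrite DE diag subrr.
have polar (u : 'cV[R[i]]_n) : D (x *m u^h) + D (u *m x^h) = 0.
  have := D0 (x + u); rewrite adjmxD mulmxDr !mulmxDl !DD !D0 add0r addr0.
  by rewrite addrC.
have p1 := polar y; have := polar ('i%C *: y).
rewrite adjmxZ conjc_i -scalemxAr -scalemxAl !DZ scaleNr => p2.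
have : 'i%C *: (D (x *m y^h) + D (y *m x^h))
    - (- ('i%C *: D (x *m y^h)) + 'i%C *: D (y *m x^h)) = 0.
  by rewrite p1 p2 scaler0 subr0.
have -> : 'i%C *: (D (x *m y^h) + D (y *m x^h))
    - (- ('i%C *: D (x *m y^h)) + 'i%C *: D (y *m x^h))
   = (2 * 'i%C) *: D (x *m y^h) by mxring.
move/eqP; rewrite scaler_eq0 mulf_eq0 pnatr_eq0 /= => /orP[/eqP[] /eqP|].
  by rewrite oner_eq0.
by rewrite DE subr_eq0 => /eqP.
Qed.

(** Flattened Kraus operators are the rows of [vecs], and the Gram matrix of [vecs] holds the
    entries of the Choi matrix, which depends only on the channel. *)
Lemma kraus_combination (R : realType) n d m (K : 'I_d -> 'M[R[i]]_n)
    (F : 'I_m -> 'M[R[i]]_n) (b : 'I_m) :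
  (forall rho, density rho -> kraus_channel K rho = kraus_channel F rho) ->
  exists v : 'I_d -> R[i], vnorm v <= 1 /\ F b = Kv K v.
Proof.
move=> /kraus_polarization KF.
pose vecs p (G : 'I_p -> 'M[R[i]]_n) := \matrix_(j, k) mxvec (G j) 0 k.
have gramE p (G : 'I_p -> 'M[R[i]]_n) a c a' c' :
    ((vecs p G)^h *m vecs p G) (mxvec_index a c) (mxvec_index a' c')
    = kraus_channel G (delta_mx c' 0 *m (delta_mx c 0 : 'cV[R[i]]_n)^h) a' a.
  rewrite mxE summxE; apply: eq_bigr => j _.
  transitivity ((col c' (G j) *m (col c (G j))^h) a' a).
    by rewrite !mxE big_ord1 !mxE !mxvecE mulrC.
  by rewrite !colE adjmxM !mulmxA.
have /(@gram_row_combination _ _ _ _ _ _ b)[v [vE v1]] :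
    (vecs d K)^h *m vecs d K = (vecs m F)^h *m vecs m F.
  apply/matrixP => i j; case/mxvec_indexP: i => a c; case/mxvec_indexP: j => a' c'.
  by rewrite !gramE KF.
exists (v 0); split.
  by rewrite vnorm_le1; move: v1; rewrite mxE; under eq_bigr do rewrite adjmxE.
apply/matrixP => a c; move/matrixP: vE => /(_ 0 (mxvec_index a c)).
rewrite !mxE mxvecE summxE => ->; apply: eq_bigr => j _.
by rewrite !mxE mxvecE.
Qed.

Lemma ket0I_isometry (R : realType) m n :
  (ket0I m n)^h *m ket0I m n = 1%:M :> 'M[R[i]]_n.
Proof. by rewrite ket0I_mul stackBK eqxx. Qed.

Lemma dilation_cost_ge (R : realType) n d m (K : 'I_d -> 'M[R[i]]_n)
    (U : 'M[R[i]]_(m.+1 * n)) :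
  (0 < n)%N -> dilates (kraus_channel K) U ->
  0 <= unitary_cost U <= pi /\
  exists v : 'I_d -> R[i], vnorm v <= 1 /\
    cos (unitary_cost U) <= lambda_min (Kv K v + (Kv K v)^h) / 2.
Proof.
move=> n0 /dilatesE[UU KU].
have mn0 : (0 < m.+1 * n)%N by rewrite muln_gt0.
have [cB cU] := unitary_cost_psd mn0 UU; split=> //.
have [v [v1 vE]] := kraus_combination 0 KU.
exists v; split => //; apply/(lambda_minP _ _ n0).
have := psd_congr (ket0I m n) cU.
rewrite -vE -ket0I_mul -[(2 * _)%:C%C%:M in X in X -> _]scalemx1.
rewrite -[(2 * _)%:C%C%:M]scalemx1 !(mulmxBl, mulmxBr, mulmxDl, mulmxDr).
by rewrite -scalemxAr -scalemxAl mulmx1 ket0I_isometry !adjmxM adjmxK !mulmxA.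
Qed.

(* With [s = 1 / (1 + sqrt (1 - |v|^2))], the [(d+1) x d] matrix whose first row is [v] and whose
   other rows form [1 - s v^* v] has orthonormal columns; it mixes the [K j] into the [F b]. *)
Lemma kraus_first_operator (R : realType) n d (K : 'I_d -> 'M[R[i]]_n)
    (v : 'I_d -> R[i]) :
  vnorm v <= 1 ->
  exists F : 'I_d.+1 -> 'M[R[i]]_n,
    [/\ F 0 = Kv K v, kraus_channel F =1 kraus_channel K &
        \sum_b (F b)^h *m F b = \sum_j (K j)^h *m K j].
Proof.
move=> v1; have [X XE] : {X | X = Kv K v} := exist _ _ erefl.
have Xh : X^h = \sum_j conjc (v j) *: (K j)^h.
  by rewrite XE adjmx_sum; apply: eq_bigr => j _; rewrite adjmxZ.
have [r [r0 r1 rE]] : exists r : R, [/\ 0 <= r, r <= 1 & \sum_j v j * conjc (v j) = r%:C%C].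
  exists (\sum_j (complex.Re (v j) ^+ 2 + complex.Im (v j) ^+ 2)); split.
  - by apply: sumr_ge0 => j _; rewrite addr_ge0 ?sqr_ge0.
  - by move: v1; rewrite /vnorm -{1}[1]sqrtr1 ler_sqrt ?ltr01.
  - by rewrite rmorph_sum; apply: eq_bigr => j _; rewrite /= add_Re2_Im2 sqr_normc.
(* The equation makes [(1 - s v^* v)^2 = 1 - v^* v]. This form of the root avoids dividing by [r],
   which may vanish. *)
have [s sE] : exists s : R, s ^+ 2 * r - 2 * s + 1 = 0.
  exists (1 + Num.sqrt (1 - r))^-1.
  have q0 : 0 <= Num.sqrt (1 - r) by apply: sqrtr_ge0.
  have qq : Num.sqrt (1 - r) ^+ 2 = 1 - r by rewrite sqr_sqrtr //; lra.
  move: q0 qq; set q := Num.sqrt _ => q0 qq.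
  have -> : r = 1 - q ^+ 2 by lra.
  by field; lra.
have sC : s%:C%C * s%:C%C * r%:C%C = 2 * s%:C%C - 1 :> R[i].
  have -> : 2 * s%:C%C - 1 = (2 * s - 1)%:C%C :> R[i].
    by rewrite rmorphB rmorphM rmorph_nat rmorph1.
  by rewrite -!rmorphM; congr (_%:C%C); rewrite -expr2; lra.
have [sc scE] : {sc | sc = s%:C%C} := exist _ _ erefl.
have scJ : conjc sc = sc by rewrite scE conjc_real.
rewrite -scE in sC.
pose G i := K i - (sc * conjc (v i)) *: X.
have Gh i : (G i)^h = (K i)^h - (sc * v i) *: X^h.
  by rewrite /G adjmxB adjmxZ rmorphM /= conjcK scJ.
exists (fun b => if unlift ord0 b is Some i then G i else X); split.
- by rewrite unlift_none -XE.
- move=> rho; rewrite /kraus_channel big_ord_recl unlift_none.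
  under eq_bigr => i _.
    rewrite liftK Gh /G.
    have -> : (K i - (sc * conjc (v i)) *: X) *m rho *m ((K i)^h - (sc * v i) *: X^h)
      = K i *m rho *m (K i)^h - sc *: ((v i *: K i) *m (rho *m X^h))
        - sc *: ((X *m rho) *m (conjc (v i) *: (K i)^h))
        + (sc * sc) *: ((v i * conjc (v i)) *: (X *m rho *m X^h)).
      mxexpand; mxring.
    over.
  rewrite !big_split /= !sumrN -!scaler_sumr -mulmx_suml -mulmx_sumr -Xh -scaler_suml.
  rewrite -/(Kv K v) -XE rE !scalerA sC !mulmxA; mxring.
rewrite big_ord_recl unlift_none.
under eq_bigr => i _.
  rewrite liftK Gh /G.
  have -> : ((K i)^h - (sc * v i) *: X^h) *m (K i - (sc * conjc (v i)) *: X)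
    = (K i)^h *m K i - sc *: ((conjc (v i) *: (K i)^h) *m X)
      - sc *: (X^h *m (v i *: K i))
      + (sc * sc) *: ((v i * conjc (v i)) *: (X^h *m X)).
    mxexpand; mxring.
  over.
rewrite !big_split /= !sumrN -!scaler_sumr -mulmx_suml -mulmx_sumr -Xh -scaler_suml.
rewrite -/(Kv K v) -XE rE !scalerA sC; mxring.
Qed.

Lemma dilation_exists (R : realType) n d (K : 'I_d -> 'M[R[i]]_n) (v : 'I_d -> R[i]) (c : R) :
  (0 < n)%N -> \sum_j (K j)^h *m K j = 1%:M -> vnorm v <= 1 -> 0 <= c < pi ->
  cos c < lambda_min (Kv K v + (Kv K v)^h) / 2 ->
  exists U : 'M[R[i]]_(d.+1 * n), dilates (kraus_channel K) U /\ unitary_cost U <= c.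
Proof.
move=> n0 KK v1 /andP[c0 cpi] hc.
have [F [F0 FK FF]] := kraus_first_operator K v1.
have VV : (stackB F)^h *m stackB F = 1%:M.
  by rewrite mulmx_blockB -KK -FF; apply: eq_bigr => b _; rewrite stackBK.
have cN1 : -1 < cos c.
  by rewrite -(cospi R) ltr_cos // in_itv /= ?lexx ?pi_ge0 // c0 ltW.
set l := lambda_min _ / 2 in hc.
(* The strict gap between [cos c] and [l] supplies the margin of the completion. *)
have l0 : 0 < 2 * (l - cos c) by rewrite mulr_gt0 // subr_gt0.
have lP : psd ((ket0I d n)^h *m stackB F + ((ket0I d n)^h *m stackB F)^h
               - (2 * cos c + 2 * (l - cos c))%:C%C%:M).
  rewrite ket0I_mul stackBK F0.
  have -> : 2 * cos c + 2 * (l - cos c) = 2 * l by lra.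
  by apply/(lambda_minP _ _ n0).
have [U [UU UE Upsd]] :=
  unitary_completion cN1 (cos_le1 c) l0 (ket0I_isometry R d n) VV lP.
exists U; split; last by apply: unitary_cost_le; rewrite ?c0 ?ltW.
apply/dilatesE; split=> // rho _; rewrite UE -FK.
by apply: eq_bigr => b _; rewrite stackBK.
Qed.

(** * Existence of a maximiser *)

Import numFieldNormedType.Exports.

Lemma KvZ (R : realType) n d (K : 'I_d -> 'M[R[i]]_n) (a : R[i]) (v : 'I_d -> R[i]) :
  Kv K (fun j => a * v j) = a *: Kv K v.
Proof. by rewrite /Kv scaler_sumr; apply: eq_bigr => j _; rewrite scalerA. Qed.

Lemma KvB (R : realType) n d (K : 'I_d -> 'M[R[i]]_n) (v w : 'I_d -> R[i]) :
  Kv K (fun j => v j - w j) = Kv K v - Kv K w.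
Proof. by rewrite /Kv -sumrB; apply: eq_bigr => j _; rewrite scalerBl. Qed.

Lemma vnormZ (R : realType) d (a : R) (v : 'I_d -> R[i]) :
  0 <= a -> vnorm (fun j => a%:C%C * v j) = a * vnorm v.
Proof.
move=> a0; have aE : a = Num.sqrt (a ^+ 2) by rewrite sqrtr_sqr ger0_norm.
rewrite /vnorm [X in _ = X * _]aE -sqrtrM ?sqr_ge0 // mulr_sumr.
congr Num.sqrt; apply: eq_bigr => j _; case: (v j) => x y /=; ring.
Qed.

Lemma sum_psd (R : realType) n I (r : seq I) (P : pred I) (F : I -> 'M[R[i]]_n) :
  (forall i, P i -> psd (F i)) -> psd (\sum_(i <- r | P i) F i).
Proof.
move=> hF; elim/big_ind: _ => //; last exact: psdD.
by move=> x; rewrite mulmx0 mul0mx mxE.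
Qed.

(** [K_v] is the first member of a Kraus family, so [K_v^* K_v] is one of the positive terms summing
    to the identity. *)
Lemma Kv_contraction (R : realType) n d (K : 'I_d -> 'M[R[i]]_n) (v : 'I_d -> R[i]) :
  \sum_j (K j)^h *m K j = 1%:M -> vnorm v <= 1 ->
  psd (1%:M - (Kv K v)^h *m Kv K v).
Proof.
move=> KK /(kraus_first_operator K)[F [F0 _ FF]].
rewrite -KK -FF big_ord_recl F0 addrC addKr.
by apply: sum_psd => j _; apply: psd_gram.
Qed.

(** The matrix is [(1 - B^* B) + (1 + B)^* (1 + B)]. *)
Lemma contraction_re_ge (R : realType) n (B : 'M[R[i]]_n) :
  psd (1%:M - B^h *m B) -> psd (B + B^h + 2 *: 1%:M).
Proof.
move=> hB; have := psdD hB (psd_gram (1%:M + B)).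
rewrite adjmxD adjmx1 !(mulmxDl, mulmxDr) !mul1mx !mulmx1.
by congr psd; mxring.
Qed.

(** This keeps the value in the domain of [acos]. A value [l > 1] contradicts [B + B^* <= 2], which
    is the previous bound for [- B]. *)
Lemma lambda_min_Kv_le1 (R : realType) n d (K : 'I_d -> 'M[R[i]]_n) (v : 'I_d -> R[i]) :
  (0 < n)%N -> \sum_j (K j)^h *m K j = 1%:M -> vnorm v <= 1 ->
  lambda_min (Kv K v + (Kv K v)^h) / 2 <= 1.
Proof.
move=> n0 KK v1; set l := _ / 2; rewrite leNgt; apply/negP => l1.
have /(lambda_minP _ _ n0) hl : l <= l by [].
have := Kv_contraction KK v1.
move: (Kv K v) hl => B hl hB.
have : psd (1%:M - (- B)^h *m (- B)) by rewrite adjmxN mulNmx mulmxN opprK.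
move=> /contraction_re_ge/(psdD hl).
have -> : B + B^h - (2 * l)%:C%C%:M + (- B + (- B)^h + 2 *: 1%:M)
    = - (2 * (l - 1))%:C%C%:M.
  rewrite -[(2 * l)%:C%C%:M]scalemx1 -[(2 * (l - 1))%:C%C%:M]scalemx1.
  rewrite adjmxN !(rmorphB, rmorphM, rmorph_nat, rmorph1) /=; mxring.
move=> /(_ (delta_mx (Ordinal n0) 0)).
rewrite -scalemx1 mulmxN mulNmx -scalemxAr -scalemxAl mulmx1.
have x0 : delta_mx (Ordinal n0) 0 != 0 :> 'cV[R[i]]_n.
  by apply/eqP => /matrixP/(_ (Ordinal n0) 0); rewrite !mxE eqxx => /eqP; rewrite oner_eq0.
rewrite oppmxE scalemxE oppr_ge0 pmulr_lle0 ?gram_gt0 //.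
by rewrite -[0]/(0%:C%C) lecR; lra.
Qed.

(** [K_w - K_v] is [r K_u] with [u] in the unit ball, so passing from [v] to [w] lowers the
    Hermitian part by at most [r]. *)
Lemma lambda_min_Kv_lipschitz (R : realType) n d (K : 'I_d -> 'M[R[i]]_n)
    (v w : 'I_d -> R[i]) (r : R) :
  (0 < n)%N -> \sum_j (K j)^h *m K j = 1%:M -> 0 < r ->
  vnorm (fun j => w j - v j) <= r ->
  lambda_min (Kv K v + (Kv K v)^h) / 2 - r <= lambda_min (Kv K w + (Kv K w)^h) / 2.
Proof.
move=> n0 KK r0 vw.
have hl := (lambda_minP (Kv K v) _ n0).1 (lexx _).
apply: (lambda_minP (Kv K w) _ n0).2; move: (lambda_min _ / 2) hl => l hl.
have u1 : vnorm (fun j => (r^-1)%:C%C * (w j - v j)) <= 1.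
  by rewrite vnormZ ?invr_ge0 ?(ltW r0) // ler_pdivrMl // mulr1.
have := contraction_re_ge (Kv_contraction KK u1).
rewrite KvZ KvB adjmxZ conjc_real adjmxB => /(psdZ (ltW r0))/(psdD hl).
congr psd; move: (Kv K v) (Kv K w) => V W.
rewrite -[(2 * l)%:C%C%:M]scalemx1 -[(2 * (l - r))%:C%C%:M]scalemx1.
have rr : r%:C%C * (r^-1)%:C%C = 1 :> R[i] by rewrite -rmorphM mulfV ?lt0r_neq0.
rewrite !scalerDr !scalerA rr !scale1r !(rmorphB, rmorphM, rmorph_nat, rmorph1) /=; mxring.
Qed.

Lemma continuous_sum (R : realType) (T : topologicalType) I (s : seq I) (F : I -> T -> R) :
  (forall i, continuous (F i)) -> continuous (fun x => \sum_(i <- s) F i x).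
Proof.
move=> cF; elim: s => [|i s IH].
  rewrite (_ : (fun _ => _) = cst 0); first exact: cst_continuous.
  by apply/funext => x; rewrite big_nil.
rewrite (_ : (fun _ => _) = F i \+ (fun x => \sum_(i <- s) F i x)).
  by move=> x; apply: continuousD; [exact: cF|exact: IH].
by apply/funext => x; rewrite big_cons.
Qed.

(** Identifies real [2 d]-space with complex [d]-space, so that compactness and the extreme value
    theorem for real vectors apply. *)
Definition cvec {R : realType} {d} (x : 'rV[R]_(d + d)) (j : 'I_d) : R[i] :=
  (x 0 (lshift d j) +i* x 0 (rshift d j))%C.

Lemma vnorm_cvec (R : realType) d (x : 'rV[R]_(d + d)) :
  vnorm (cvec x) = Num.sqrt (\sum_i x 0 i ^+ 2).
Proof. by rewrite /vnorm big_split_ord /= -big_split. Qed.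

Lemma unit_ball_compact (R : realType) n :
  compact [set x : 'rV[R]_n | \sum_i x 0 i ^+ 2 <= 1]%classic.
Proof.
apply: (@subclosed_compact _ _ [set x : 'rV[R]_n | forall i, `[-1, 1]%classic (x 0 i)]%classic).
- apply: (@preimage_closed _ _ (fun x : 'rV[R]_n => \sum_i x 0 i ^+ 2)
            [set y : R | y <= 1]%classic); last exact: closed_le.
  move=> x _; apply: continuous_sum => i y.
  have c := @coord_continuous R 1 n 0 i y; exact: (cvgM c c).
- have := @rV_compact R n (fun=> `[-1, 1]%classic); apply => _; exact: segment_compact.
- move=> x /= hx i; rewrite in_itv /= -ler_norml -(@expr_le1 _ 2) // real_normK ?num_real //.
  by apply: le_trans hx; rewrite (bigD1 i) //= lerDl sumr_ge0 // => k _; rewrite sqr_ge0.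
Qed.

Lemma lambda_min_Kv_max (R : realType) n d (K : 'I_d -> 'M[R[i]]_n) :
  (0 < n)%N -> \sum_j (K j)^h *m K j = 1%:M ->
  exists v0 : 'I_d -> R[i], vnorm v0 <= 1 /\
    forall v, vnorm v <= 1 ->
      lambda_min (Kv K v + (Kv K v)^h) / 2 <= lambda_min (Kv K v0 + (Kv K v0)^h) / 2.
Proof.
move=> n0 KK.
pose f x := lambda_min (Kv K (cvec x) + (Kv K (cvec x))^h) / 2.
have ball (x : 'rV[R]_(d + d)) : (vnorm (cvec x) <= 1) = (\sum_i x 0 i ^+ 2 <= 1).
  by rewrite vnorm_cvec -{1}[1]sqrtr1 ler_sqrt ?ltr01.
have fc : continuous f.
  move=> x; apply: (@cvgrPdist_le R R _ (nbhs x) (nbhs_filter x) f (f x)).2 => e e0.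
  (* Coordinates within [e / N] give Euclidean distance at most [e], because [2 d <= N^2]; the
     successor makes [N] positive outright. *)
  pose N := (d + d).+1%:R : R.
  have N0 : 0 < N by rewrite ltr0n.
  have : nbhs x [set y : 'rV[R]_(d + d) | forall i, `|x 0 i - y 0 i| <= e / N]%classic.
    apply: (@filter_forall _ _ (fun i (y : 'rV[R]_(d + d)) => `|x 0 i - y 0 i| <= e / N)
      _ (nbhs_filter x)) => i.
    have /cvgrPdist_le c := @coord_continuous R 1 (d + d) 0 i x; exact: (c _ (divr_gt0 e0 N0)).
  apply: (@filterS _ _ (nbhs_filter x)) => y xy.
  have S (a b : 'rV[R]_(d + d)) : (forall i, `|a 0 i - b 0 i| <= e / N) -> f a - e <= f b.
    move=> ab; apply: (@lambda_min_Kv_lipschitz R n d K (cvec a) (cvec b) e n0 KK e0).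
    have -> : (fun j => cvec b j - cvec a j) = cvec (b - a).
      by apply/funext => j; rewrite /cvec !mxE.
    rewrite vnorm_cvec -[leRHS]gtr0_norm // -sqrtr_sqr ler_sqrt ?sqr_ge0 //.
    apply: (@le_trans _ _ (\sum_(i < d + d) (e / N) ^+ 2)).
      apply: ler_sum => i _; rewrite !mxE -real_normK ?num_real // lerXn2r ?nnegrE //.
        by rewrite ltW ?divr_gt0.
      by rewrite distrC.
    rewrite sumr_const card_ord -mulr_natl expr_div_n mulrCA ler_piMr ?sqr_ge0 //.
    rewrite ler_pdivrMr ?exprn_gt0 // mul1r /N -natrX ler_nat.
    by rewrite (leq_trans (leqnSn _)) // leq_pmulr.
  rewrite ler_distl; have := S _ _ xy.
  have yx i : `|y 0 i - x 0 i| <= e / N by rewrite distrC.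
  by have := S _ _ yx; move: (f x) (f y) => s t h1 h2; apply/andP; split; lra.
have A0 : ([set x : 'rV[R]_(d + d) | (\sum_i x 0 i ^+ 2 <= 1)%R] !=set0)%classic.
  by exists 0; rewrite /= big1 // => i _; rewrite mxE expr0n.
have [c cA cmax] := EVT_max_rV A0 (@unit_ball_compact R _) (continuous_subspaceT fc).
exists (cvec c); split; first by rewrite ball; rewrite inE in cA.
move=> v v1.
pose x : 'rV[R]_(d + d) := row_mx (\row_j complex.Re (v j)) (\row_j complex.Im (v j)).
have vx : cvec x = v.
  by apply/funext => j; rewrite /cvec row_mxEl row_mxEr !mxE; case: (v j).
by have := cmax x; rewrite /f vx; apply; rewrite inE /= -ball vx.
Qed.

(** * The cost of a channel *)

(** Every dilation costs at least [acos l], and dilations of cost at most [c] exist for each [c]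
    strictly between [acos l] and [pi]. *)
Lemma channel_cost_max (R : realType) n d (K : 'I_d -> 'M[R[i]]_n) (v0 : 'I_d -> R[i]) (l : R) :
  (0 < n)%N -> \sum_j (K j)^h *m K j = 1%:M -> vnorm v0 <= 1 ->
  (forall v, vnorm v <= 1 -> lambda_min (Kv K v + (Kv K v)^h) / 2 <= l) ->
  lambda_min (Kv K v0 + (Kv K v0)^h) / 2 = l ->
  channel_cost (kraus_channel K) = acos l.
Proof.
move=> n0 KK v01 lmax lE.
have l1 : l <= 1 by rewrite -lE; apply: lambda_min_Kv_le1.
(* The vector 0 already gives the value 0. Hence [acos l < pi], which leaves room for such [c]. *)
have l0 : 0 <= l.
  apply: (le_trans _ (lmax (fun=> 0) _)).
    apply: (lambda_minP _ _ n0).2; rewrite /Kv big1 => [|j _]; last exact: scale0r.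
    rewrite adjmx0 mulr0 !addr0 sub0r -scalemx1 scale0r oppr0 => x.
    by rewrite mulmx0 mul0mx mxE.
  by rewrite /vnorm big1 ?sqrtr0 // => j _; rewrite expr0n addr0.
have lB : -1 <= l <= 1 by rewrite l1 andbT (le_trans _ l0) // lerN10.
have [/andP[a0 api] ca] := acos_def lB.
have altpi : acos l < pi by rewrite acos_ltpi // l1 andbT (lt_le_trans _ l0) // ltrN10.
rewrite /channel_cost; set S := (X in inf X).
have lbS : lbound S (acos l).
  move=> _ [m [U [KU ->]]].
  have [cB [v [v1 cv]]] := dilation_cost_ge n0 KU.
  rewrite -(ler_cos_pi cB) ?a0 // ca.
  exact: le_trans cv (lmax v v1).
have approx c : acos l < c -> c < pi -> exists2 x, S x & x <= c.
  move=> ac cpi; have c0 : 0 <= c by rewrite (le_trans a0) // ltW.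
  have hc : cos c < lambda_min (Kv K v0 + (Kv K v0)^h) / 2.
    by rewrite lE -ca ltr_cos // in_itv /= ?a0 ?c0 // ltW.
  have cB : 0 <= c < pi by rewrite c0.
  have [U [KU Uc]] := dilation_exists n0 KK v01 cB hc.
  by exists (unitary_cost U) => //; exists d, U.
have S0 : (S !=set0)%classic.
  have [||x Sx _] := approx ((acos l + pi) / 2); [lra|lra|].
  by exists x.
apply/eqP; rewrite eq_le; apply/andP; split; last exact: lb_le_inf.
rewrite leNgt; apply/negP => infS.
(* The midpoint is taken against the smaller of [pi] and [inf S], since dilations are only built for
   [c < pi]. *)
have [c [ac cpi cS]] : exists c, [/\ acos l < c, c < pi & c < inf S].
  have [h|h] := lerP pi (inf S).
    by exists ((acos l + pi) / 2); split; lra.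
  by exists ((acos l + inf S) / 2); split; lra.
have [x Sx xc] := approx c ac cpi.
have : inf S <= x by apply: ge_inf => //; exists (acos l).
by move=> h; have := lt_le_trans cS (le_trans h xc); rewrite ltxx.
Qed.

(** The maximum is expressed by a maximiser [v0]; [0 < n] makes the spectra nonempty. *)
Theorem theorem1 (R : realType) (n d : nat) (K : 'I_d -> 'M[R[i]]_n) :
  (0 < n)%N ->
  \sum_(j < d) adjmx (K j) *m K j = 1%:M ->
  exists v0 : 'I_d -> R[i],
    vnorm v0 <= 1 /\
    (forall v : 'I_d -> R[i], vnorm v <= 1 ->
       lambda_min (Kv K v + adjmx (Kv K v)) / 2
       <= lambda_min (Kv K v0 + adjmx (Kv K v0)) / 2) /\
    channel_cost (kraus_channel K) =
      acos (lambda_min (Kv K v0 + adjmx (Kv K v0)) / 2).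
Proof.
move=> n0 KK; have [v0 [v01 vmax]] := lambda_min_Kv_max n0 KK.
exists v0; split=> //; split=> //.
exact: (channel_cost_max n0 KK v01 vmax erefl).
Qed.
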